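(* Let $\varphi : A \to B$ be a homomorphism of commutative rings. Suppose that $aB \cap A = (a)$ (that is, $\varphi^{-1}(\varphi(a)B) = aA$) and $\varphi(a) \in W(B)$ for every $a \in W(A)$. If $B$ is a weakly Arf ring, then so is $A$.
   Context: For a commutative ring $A$, $Q(A)$ denotes its total ring of fractions and $W(A)$ the set of non-zerodivisors on $A$. $A$ is weakly Arf if $yz/x \in A$ whenever $x,y,z\in A$ are such that $x\in W(A)$ and $y/x, z/x \in Q(A)$ are integral over $A$. *)

(* Defs.v *)
From HB Require Import structures.
From mathcomp Require Import all_boot all_algebra generic_quotient.
From mathcomp Require Import boolp classical_sets.

Set Implicit Arguments.
Unset Strict Implicit.
Unset Printing Implicit Defensive.

Import GRing.Theory.
Local Open Scope ring_scope.
Local Open Scope classical_set_scope.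
Local Open Scope quotient_scope.

(* Commutative rings are [comPzRingType]s, so the zero ring is allowed; there
   [nonzerodiv] is the whole ring. *)
Definition nonzerodiv (R : comPzRingType) : set R :=
  [set x | forall y : R, x * y = 0 -> y = 0].
Arguments nonzerodiv R _ : clear implicits.

Definition principal_ideal (R : comPzRingType) (a : R) : set R :=
  [set a * r | r in [set: R]].

Lemma nonzerodiv1 (R : comPzRingType) : (1 : R) \in nonzerodiv R.
Proof. by apply/mem_set => y; rewrite mul1r. Qed.

Lemma nonzerodivM (R : comPzRingType) (x y : R) :
  x \in nonzerodiv R -> y \in nonzerodiv R -> x * y \in nonzerodiv R.
Proof.
move=> /set_mem Wx /set_mem Wy; apply/mem_set => z.
by rewrite -mulrA => /Wx/Wy.
Qed.

Lemma nonzerodivI (R : comPzRingType) (x : nonzerodiv R) (y z : R) :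
  val x * y = val x * z -> y = z.
Proof.
case: x => x /= /set_mem Wx xyz; apply/eqP; rewrite -subr_eq0; apply/eqP/Wx.
by rewrite mulrBr xyz subrr.
Qed.

Module TotalFrac.
Section TotalFrac.
Variable R : comPzRingType.

Local Notation W := (nonzerodiv R).
Local Notation pre := (R * W)%type.

Definition one_den : W := Sub 1 (nonzerodiv1 R).
Definition mul_den (s t : W) : W :=
  Sub (val s * val t) (nonzerodivM (valP s) (valP t)).

(* Since denominators are non-zerodivisors, the usual extra factor in the
   equivalence defining a localization is not needed. *)
Definition equivf (u v : pre) := u.1 * val v.2 == v.1 * val u.2.

Lemma equivf_refl : reflexive equivf.
Proof. by move=> u; rewrite /equivf. Qed.

Lemma equivf_sym : symmetric equivf.
Proof. by move=> u v; rewrite /equivf eq_sym. Qed.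

Lemma equivf_trans : transitive equivf.
Proof.
move=> v u w /eqP uv /eqP vw; apply/eqP; apply: (@nonzerodivI _ v.2).
by rewrite mulrA [_ * u.1]mulrC uv mulrAC vw -mulrA mulrCA.
Qed.

Canonical equivf_equiv := EquivRel equivf equivf_refl equivf_sym equivf_trans.

Definition type := {eq_quot equivf}.

HB.instance Definition _ : EqQuotient _ equivf type := EqQuotient.on type.
HB.instance Definition _ := Choice.on type.

Definition frac (y : R) (x : W) : type := \pi_type (y, x).

Lemma fracP (y z : R) (x w : W) :
  frac y x = frac z w <-> y * val w = z * val x.
Proof. by rewrite /frac; split=> [/eqmodP/eqP|yz]; last apply/eqmodP/eqP. Qed.

Lemma fracW (P : type -> Prop) : (forall y x, P (frac y x)) -> forall u, P u.
Proof. by move=> H; elim/quotW => -[y x]; exact: H. Qed.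

Definition add_pre (u v : pre) : pre :=
  (u.1 * val v.2 + v.1 * val u.2, mul_den u.2 v.2).
Definition opp_pre (u : pre) : pre := (- u.1, u.2).
Definition mul_pre (u v : pre) : pre := (u.1 * v.1, mul_den u.2 v.2).

Definition zero : type := frac 0 one_den.
Definition one : type := frac 1 one_den.
Definition add (u v : type) : type := \pi_type (add_pre (repr u) (repr v)).
Definition opp (u : type) : type := \pi_type (opp_pre (repr u)).
Definition mul (u v : type) : type := \pi_type (mul_pre (repr u) (repr v)).

Lemma repr_frac y x :
  (repr (frac y x)).1 * val x = y * val (repr (frac y x)).2.
Proof. by apply/fracP; rewrite /frac -surjective_pairing reprK. Qed.

Lemma addE y z x w :
  add (frac y x) (frac z w) = frac (y * val w + z * val x) (mul_den x w).
Proof.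
apply/fracP => /=; have := repr_frac y x; have := repr_frac z w.
case: (repr (frac y x)) => a s; case: (repr (frac z w)) => b t /= e2 e1.
rewrite !mulrDl; congr (_ + _).
  by rewrite mulrACA e1 [val t * _]mulrC mulrACA.
by rewrite [val x * _]mulrC mulrACA e2 [val s * _]mulrC mulrACA [val t * _]mulrC.
Qed.

Lemma oppE y x : opp (frac y x) = frac (- y) x.
Proof. by apply/fracP => /=; rewrite !mulNr repr_frac. Qed.

Lemma mulE y z x w : mul (frac y x) (frac z w) = frac (y * z) (mul_den x w).
Proof. by apply/fracP => /=; rewrite mulrACA !repr_frac mulrACA. Qed.

Lemma addA : associative add.
Proof.
elim/fracW => a s; elim/fracW => b t; elim/fracW => c u; rewrite !addE.
apply/fracP => /=; rewrite !mulrDl !addrA !mulrA.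
by rewrite [b * val u * _]mulrAC [c * val t * _]mulrAC.
Qed.

Lemma addC : commutative add.
Proof.
elim/fracW => a s; elim/fracW => b t; rewrite !addE; apply/fracP => /=.
by rewrite addrC [val t * _]mulrC.
Qed.

Lemma add0 : left_id zero add.
Proof.
elim/fracW => a s; rewrite addE; apply/fracP => /=.
by rewrite mul0r add0r mulr1 mul1r.
Qed.

Lemma addN : left_inverse zero opp add.
Proof.
elim/fracW => a s; rewrite oppE addE; apply/fracP => /=.
by rewrite mulNr addNr !mul0r.
Qed.

HB.instance Definition _ := GRing.isZmodule.Build type addA addC add0 addN.

Lemma mulA : associative mul.
Proof.
elim/fracW => a s; elim/fracW => b t; elim/fracW => c u; rewrite !mulE.
by apply/fracP => /=; rewrite !mulrA.
Qed.

Lemma mulC : commutative mul.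
Proof.
elim/fracW => a s; elim/fracW => b t; rewrite !mulE; apply/fracP => /=.
by rewrite [a * b]mulrC [val t * _]mulrC.
Qed.

Lemma mul1 : left_id one mul.
Proof.
by elim/fracW => a s; rewrite mulE; apply/fracP => /=; rewrite !mul1r.
Qed.

Lemma mulD : left_distributive mul add.
Proof.
elim/fracW => a s; elim/fracW => b t; elim/fracW => c u.
rewrite !(mulE, addE); apply/fracP => /=; rewrite !mulrDl.
by congr (_ + _); rewrite (AC (3*(2*2)) ((1*3)*(2*5)*(4*6*7))).
Qed.

HB.instance Definition _ :=
  GRing.Zmodule_isComPzRing.Build type mulA mulC mul1 mulD.

End TotalFrac.
End TotalFrac.

Definition total_frac (R : comPzRingType) : Type := TotalFrac.type R.

Section TotalFracRing.
Import TotalFrac.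
HB.instance Definition _ (R : comPzRingType) :=
  GRing.ComPzRing.copy (total_frac R) (TotalFrac.type R).
End TotalFracRing.

Definition frac (R : comPzRingType) (y : R) (x : nonzerodiv R) : total_frac R :=
  TotalFrac.frac y x.

Definition to_total_frac (R : comPzRingType) (a : R) : total_frac R :=
  frac a (TotalFrac.one_den R).

Section TotalFracTheory.
Variable R : comPzRingType.
Implicit Types (y z : R) (x w : nonzerodiv R).

Lemma fracP y z x w : frac y x = frac z w <-> y * val w = z * val x.
Proof. exact: TotalFrac.fracP. Qed.

Lemma frac_surj (u : total_frac R) : exists y x, u = frac y x.
Proof. by elim/TotalFrac.fracW: u => y x; exists y, x. Qed.

Lemma frac_add y z x w :
  frac y x + frac z w = frac (y * val w + z * val x) (TotalFrac.mul_den x w).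
Proof. exact: TotalFrac.addE. Qed.

Lemma frac_mul y z x w :
  frac y x * frac z w = frac (y * z) (TotalFrac.mul_den x w).
Proof. exact: TotalFrac.mulE. Qed.

Lemma to_total_frac_is_zmod_morphism : zmod_morphism (@to_total_frac R).
Proof.
move=> y z; rewrite /to_total_frac.
have -> : - frac z (TotalFrac.one_den R) = frac (- z) (TotalFrac.one_den R).
  exact: TotalFrac.oppE.
by rewrite frac_add; apply/fracP => /=; rewrite !mulr1.
Qed.

Lemma to_total_frac_is_monoid_morphism : monoid_morphism (@to_total_frac R).
Proof.
split=> [//|y z]; rewrite /to_total_frac frac_mul.
by apply/fracP => /=; rewrite !mulr1.
Qed.

HB.instance Definition _ := GRing.isZmodMorphism.Build R (total_frac R)
  (@to_total_frac R) to_total_frac_is_zmod_morphism.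
HB.instance Definition _ := GRing.isMonoidMorphism.Build R (total_frac R)
  (@to_total_frac R) to_total_frac_is_monoid_morphism.

Lemma to_total_frac_inj : injective (@to_total_frac R).
Proof. by move=> y z /fracP /=; rewrite !mulr1. Qed.

Lemma frac_divK y x : frac y x * to_total_frac (val x) = to_total_frac y.
Proof. by rewrite frac_mul; apply/fracP => /=; rewrite !mulr1. Qed.

End TotalFracTheory.

(* The library's [integralOver] is only available for nonzero rings, because
   polynomials are; see [is_integralP] for the comparison. *)
Definition is_integral (R K : comPzRingType) (f : R -> K) (u : K) : Prop :=
  exists (n : nat) (c : 'I_n -> R), u ^+ n + \sum_(i < n) f (c i) * u ^+ i = 0.

Lemma is_integralP (R K : comNzRingType) (f : {rmorphism R -> K}) (u : K) :
  is_integral f u <-> integralOver f u.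
Proof.
split=> [[n [c cu0]]|[p p_monic /rootP pu0]].
  pose q := \poly_(i < n) (if insub i is Some j then c j else 0).
  have sq : (size q < size ('X^n : {poly R}))%N.
    by rewrite size_polyXn ltnS size_poly.
  exists ('X^n + q); first by rewrite monicE lead_coefDl // lead_coefXn.
  apply/rootP; rewrite rmorphD /= map_polyXn hornerD hornerXn -[RHS]cu0.
  congr (_ + _).
  rewrite (@horner_coef_wide _ n); last first.
    by rewrite (leq_trans (size_poly _ _)) // size_poly.
  by apply: eq_bigr => i _; rewrite coef_map coef_poly ltn_ord valK.
exists (size p).-1, (fun i => p`_i).
rewrite -[RHS]pu0 (@horner_coef_wide _ (size p)); last exact: size_poly.
have := monic_neq0 p_monic; rewrite -size_poly_gt0 => /prednK sp.
rewrite -[in RHS]sp big_ord_recr /= addrC; congr (_ + _).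
  have -> : (map_poly f p)`_(size p).-1 = 1.
    by rewrite coef_map -lead_coefE (monicP p_monic); exact: rmorph1.
  by rewrite mul1r.
by apply: eq_bigr => i _; rewrite coef_map.
Qed.

Definition integral_in_total_frac (R : comPzRingType) (u : total_frac R) :=
  is_integral (@to_total_frac R) u.

Definition weakly_arf (R : comPzRingType) : Prop :=
  forall (x : nonzerodiv R) (y z : R),
    integral_in_total_frac (frac y x) -> integral_in_total_frac (frac z x) ->
    range (@to_total_frac R) (frac (y * z) x).

(* Main.v *)
Require Import Defs.
From mathcomp Require Import all_boot all_algebra.
From mathcomp Require Import classical_sets.

(** A fraction [y / x] is integral over the ring exactly when numerator and
    denominator satisfy a homogeneous equation
    [y ^ n + \sum_(i < n) c_i * y ^ i * x ^ (n - i) = 0], which lives in the ring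
    itself ([integral_fracP]).  Such an equation is carried along by any ring
    morphism [phi], so as long as [phi] keeps the denominator regular it sends
    integral fractions to integral fractions ([integral_frac_morph]), and there
    is no need to extend [phi] to the total rings of fractions.

    Hence, if [y / x] and [z / x] are integral over [A], then
    [phi y / phi x] and [phi z / phi x] are integral over [B], and the weakly
    Arf property of [B] makes [phi (y * z)] a multiple of [phi x].  The
    contraction hypothesis [phi^-1 (phi x B) = x A] turns this into the
    divisibility of [y * z] by [x] in [A], which is the claim
    ([range_fracP]). *)

Import GRing.Theory.
(* Makes [frac] a fraction with regular denominator again, rather than one over
   an integral domain. *)
Import Defs.
Local Open Scope ring_scope.
Local Open Scope classical_set_scope.

Lemma to_total_frac_invr (R : comPzRingType) (x : nonzerodiv R) :
  to_total_frac (val x) * frac 1 x = 1.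
Proof. by rewrite mulrC frac_divK. Qed.

Lemma range_fracP (R : comPzRingType) (y : R) (x : nonzerodiv R) :
  range (@to_total_frac R) (frac y x) <-> principal_ideal (val x) y.
Proof.
split=> -[r _].
  by move=> /fracP /=; rewrite mulr1 mulrC => xr; exists r.
by move=> xr; exists r => //; apply/fracP; rewrite /= mulr1 mulrC.
Qed.

(** Multiplying an integral equation of [y / x] by [x ^ n] clears the
    denominators; this loses nothing because [x] is invertible in the total ring
    of fractions, into which the ring embeds. *)
Lemma integral_fracP (R : comPzRingType) (y : R) (x : nonzerodiv R) :
  integral_in_total_frac (frac y x) <->
  exists (n : nat) (c : 'I_n -> R),
    y ^+ n + \sum_(i < n) c i * (y ^+ i * val x ^+ (n - i)) = 0.
Proof.
set u := frac y x.
have clear_den n (c : 'I_n -> R) :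
    (u ^+ n + \sum_(i < n) to_total_frac (c i) * u ^+ i)
      * to_total_frac (val x) ^+ n =
    to_total_frac (y ^+ n + \sum_(i < n) c i * (y ^+ i * val x ^+ (n - i))).
  rewrite rmorphD rmorph_sum rmorphXn /= -(frac_divK y x).
  rewrite exprMn mulrDl mulr_suml.
  congr (_ + _); apply: eq_bigr => i _.
  rewrite !rmorphM !rmorphXn /= -(frac_divK y x) exprMn -!mulrA -exprD.
  by rewrite subnKC // ltnW.
split=> -[n [c eq0]]; exists n, c.
  by apply: to_total_frac_inj; rewrite -clear_den eq0 mul0r rmorph0.
rewrite -[LHS]mulr1 -(expr1n _ n) -(to_total_frac_invr R x) exprMn mulrA.
by rewrite clear_den eq0 rmorph0 mul0r.
Qed.

Lemma integral_frac_morph (A B : comPzRingType) (phi : {rmorphism A -> B})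
    (y : A) (x : nonzerodiv A) (w : nonzerodiv B) :
  val w = phi (val x) ->
  integral_in_total_frac (frac y x) ->
  integral_in_total_frac (frac (phi y) w).
Proof.
move=> wE /integral_fracP [n [c eq0]].
apply/integral_fracP; exists n, (phi \o c).
rewrite -[RHS](rmorph0 phi) -eq0 rmorphD rmorph_sum rmorphXn wE.
by congr (_ + _); apply: eq_bigr => i _; rewrite !rmorphM !rmorphXn.
Qed.

Theorem proposition3p1 (A B : comPzRingType) (phi : {rmorphism A -> B})
  (hideal : forall a : A, nonzerodiv A a ->
     phi @^-1` principal_ideal (phi a) = principal_ideal a)
  (hreg : forall a : A, nonzerodiv A a -> nonzerodiv B (phi a))
  (hB : weakly_arf B) :
  weakly_arf A.
Proof.
move=> x y z y_int z_int.
have Wx : nonzerodiv A (val x) by apply: set_mem; apply: valP.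
pose w : nonzerodiv B := Sub (phi (val x)) (mem_set (hreg _ Wx)).
apply/range_fracP; rewrite -(hideal _ Wx) /preimage /= rmorphM.
apply/(range_fracP B _ w); apply: hB.
  exact: integral_frac_morph y_int.
exact: integral_frac_morph z_int.
Qed.
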